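(* Let $p>1$. There is no constant $C>0$ such that $$C\,W_p^2(\mu,\nu)\le\mathcal{H}(\mu,\nu)$$ holds for all probability measures $\mu,\nu$ supported in $[-2,2]$.
   Context: For $p\ge1$, $W_p(\mu,\nu)=\left\{\inf_{\pi\in\Pi(\mu,\nu)}\int|x-y|^p\,\pi(dx\,dy)\right\}^{1/p}$, where $\Pi(\mu,\nu)$ is the set of probability measures on $\mathbb{R}^2$ with marginals $\mu,\nu$. The free reduced relative entropy of compactly supported probability measures is $\mathcal{H}(\mu,\nu)=-\iint\log|x-y|(\mu-\nu)(dx)(\mu-\nu)(dy)$ if $\iint|\log|x-y||\mu(dx)\mu(dy)<\infty$ and $\iint|\log|x-y||\nu(dx)\nu(dy)<\infty$, and $+\infty$ otherwise. *)

(* Defs.v *)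
From HB Require Import structures.
From mathcomp Require Import all_boot all_order all_algebra.
From mathcomp Require Import all_classical all_reals all_analysis.

Set Implicit Arguments.
Unset Strict Implicit.
Unset Printing Implicit Defensive.

Import Order.TTheory GRing.Theory Num.Theory.
Import numFieldNormedType.Exports.

Local Open Scope classical_set_scope.
Local Open Scope ring_scope.

Notation borel_probability R := (probability (measurableTypeR R) R).

Section Defs.
Context {R : realType}.
Implicit Types mu nu : borel_probability R.

(* For closed A this says that the topological support of mu lies in A. *)
Definition supported_in (A : set R) mu : Prop := mu (~` A) = 0%E.

Definition couplings mu nu
    : set (probability (measurableTypeR R * measurableTypeR R)%type R) :=
  fun pi => forall A : set (measurableTypeR R), measurable A ->
    pushforward pi fst A = mu A /\ pushforward pi snd A = nu A.

Local Open Scope ereal_scope.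

Definition wasserstein (p : R) mu nu : \bar R :=
  ereal_inf [set \int[pi]_z ((`|z.1 - z.2| `^ p)%R)%:E | pi in couplings mu nu]
    `^ (p^-1)%R.

(* lne (unlike ln) takes the value -oo at 0, so that the diagonal contributes
   to the integrals below as it should: a measure with an atom has infinite
   logarithmic energy. *)
Definition logdist (x y : R) : \bar R := lne (`|x - y|%R)%:E.

Definition finite_log_energy mu : bool :=
  (\int[mu]_y \int[mu]_x `|logdist x y|) < +oo.

(* The integral of f against the signed measure mu - nu. *)
Definition integral_diff mu nu (f : R -> \bar R) : \bar R :=
  (\int[mu]_x f x) - (\int[nu]_x f x).

(* When both log energies are finite and the supports are compact, the inner
   integral against mu - nu is a difference of finite numbers for (mu + nu)-a.e.
   y, and the outer one is finite, so no oo - oo convention is involved. *)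
Definition free_entropy mu nu : \bar R :=
  if finite_log_energy mu && finite_log_energy nu then
    - integral_diff mu nu (fun y => integral_diff mu nu (fun x => logdist x y))
  else +oo.

End Defs.

(* Main.v *)
Require Import Defs.
From HB Require Import structures.
From mathcomp Require Import all_boot all_order all_algebra.
From mathcomp Require Import all_classical all_reals all_analysis.
From mathcomp Require Import measurable_realfun lra.
Import Order.TTheory GRing.Theory Num.Theory.
Import numFieldNormedType.Exports.
Local Open Scope classical_set_scope.
Local Open Scope ring_scope.

(** The two sides scale differently when a small amount of mass is moved over a
    fixed distance.  Let P and Q be the uniform measures on [-2, -1] and [1, 2],
    and compare mu = t P + (1 - t) Q with nu = Q.  Then mu - nu = t (P - Q), so
    the free entropy, being quadratic in mu - nu, equals t^2 K for a constant K
    independent of t (free_entropy_mixture).  On the other hand every coupling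
    must carry the mass t from [-2, -1] to [1, 2], hence over a distance at
    least 1, so W_p^p >= t and W_p^2 >= t^(2/p) (wasserstein_ge).  The
    inequality would give C t^(2/p) <= t^2 K for all t in [0, 1], which fails
    for small t because 2/p < 2 (small_powR).

    The analytic content is that K is finite and that the bilinear expansion of
    the entropy is legitimate, which requires the logarithmic kernel to be
    integrable for all the products of measures involved.  The class of
    log-tame measures, whose logarithmic potentials grow at most linearly and
    whose first moment is finite, ensures this; it is closed under mixtures and contains the uniform measures,
    by a dyadic bound of the logarithm (abse_lne_le). *)

(** * A dyadic bound of the logarithm *)

Section log_bound.
Context {R : realType}.

Lemma le_half_pow (r : R) (k : nat) : 0 < r -> k%:R <= - ln r -> r <= 2^-1 ^+ k.
Proof.
move=> r0 kr; rewrite -[r]lnK ?posrE// -[ln r]opprK expRN exprVn.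
rewrite lef_pV2 ?posrE ?expR_gt0 ?exprn_gt0//.
apply: (@le_trans _ _ (expR k%:R)); last by rewrite ler_expR.
rewrite -[k%:R]mulr1 expRM_natl lerXn2r ?nnegrE ?expR_ge0//.
by have := expR_ge1Dx (1 : R).
Qed.

Local Open Scope ereal_scope.

(** For r < 1 the series counts the k with r <= 2^-k, and every k <= - ln r is
    one of them since 2 <= e; for r >= 1 the bound ln r <= r suffices.  At
    r = 0 both sides are infinite.  Integrating against a measure turns the
    series into a sum of masses of balls of radius 2^-k, so no antiderivative of
    the logarithm is needed. *)
Lemma abse_lne_le (r : R) : (0 <= r)%R ->
  `|lne r%:E| <= \sum_(k <oo) (\1_[set s : R | s <= 2^-1 ^+ k]%R r)%:E + r%:E.
Proof.
move=> r0.
pose f (k : nat) : \bar R := (\1_[set s : R | s <= 2^-1 ^+ k]%R r)%:E.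
rewrite -/f.
have f0 k : 0 <= f k by rewrite /f lee_fin.
have partial N : (forall k, (k < N)%N -> (r <= 2^-1 ^+ k)%R) ->
    N%:R%:E <= \sum_(k <oo) f k.
  move=> rN; apply: le_trans (nneseries_lim_ge N (fun n _ _ => f0 n)).
  rewrite (eq_big_nat _ _ (F2 := fun=> 1)); last first.
    by move=> k /andP[_ kN]; rewrite /f indicE mem_set//= rN.
  by rewrite sumEFin lee_fin big_const_nat subn0 iter_addr_0.
have [r_gt0|] := ltP 0%R r; last first.
  rewrite le_eqVlt ltNge r0 orbF => /eqP r_eq0.
  rewrite (_ : \sum_(_ <oo) _ = +oo) ?addye ?leey//.
  apply/eqyP => A A0; apply: le_trans (partial (Num.truncn A).+1 _).
    by rewrite lee_fin ltW// truncnS_gt.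
  by move=> k _; rewrite r_eq0 exprn_ge0.
rewrite lne_EFin//; have [r1|r1] := leP 1%R r.
  rewrite gee0_abs ?lee_fin ?ln_ge0// (@le_trans _ _ r%:E)//.
    by rewrite lee_fin ltW// ln_sublinear.
  by rewrite leeDr// nneseries_ge0.
have lnr0 : (0 <= - ln r)%R by rewrite oppr_ge0 ln_le0 ?ltW.
rewrite lee0_abs ?lee_fin -?oppr_ge0//.
apply: (@le_trans _ _ (\sum_(k <oo) f k)); last by rewrite leeDl ?lee_fin.
apply: le_trans (partial (Num.truncn (- ln r)).+1 _).
  by rewrite lee_fin ltW// truncnS_gt.
move=> k; rewrite ltnS => kr; apply: le_half_pow => //.
apply: (@le_trans _ _ (Num.truncn (- ln r))%:R).
  by rewrite ler_nat.
by rewrite truncn_le.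
Qed.

Lemma measurable_lne : measurable_fun [set: R] (fun r : R => lne r%:E).
Proof.
rewrite /lne/=; apply: measurable_fun_ifT => //=.
- exact: measurable_fun_ler.
- by apply/measurable_EFinP; exact: measurable_ln.
Qed.

(** The variables are swapped so that integrating out the second component of
    the pair is integrating out the first argument of logdist, as in the
    definition of the entropy. *)
Lemma measurable_logdist : measurable_fun setT
  (fun z : measurableTypeR R * measurableTypeR R => logdist z.2 z.1).
Proof.
apply: (measurableT_comp measurable_lne).
apply: measurableT_comp => //; exact: measurable_funB.
Qed.

Lemma measurable_logdist_l (y : R) :
  measurable_fun setT (fun x : measurableTypeR R => logdist x y).
Proof.
apply: (measurableT_comp measurable_lne).
apply: measurableT_comp => //; exact: measurable_funB.
Qed.

End log_bound.

(** * Mixtures of two probability measures *)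

Section mixture.
Local Open Scope ereal_scope.
Context {d} {T : measurableType d} {R : realType}.
Context (t : {i01 R}) (P Q : probability T R).

Definition mixture : set T -> \bar R :=
  measure_add (mscale (t%:num%:nng)%R P) (mscale ((1 - t%:num)%:nng)%R Q).

Lemma mixtureE A : mixture A = t%:num%:E * P A + (1 - t%:num)%R%:E * Q A.
Proof. by rewrite /mixture measure_addE. Qed.

HB.instance Definition _ := Measure.on mixture.

Let mixture_setT : mixture setT = 1.
Proof. by rewrite mixtureE !probability_setT !mule1 -EFinD addrC subrK. Qed.

HB.instance Definition _ :=
  Measure_isProbability.Build _ _ _ mixture mixture_setT.

Lemma ge0_integral_mixture (f : T -> \bar R) :
  measurable_fun setT f -> (forall x, 0 <= f x) ->
  \int[mixture]_x f x =
  t%:num%:E * \int[P]_x f x + (1 - t%:num)%R%:E * \int[Q]_x f x.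
Proof.
by move=> mf f0; rewrite ge0_integral_measure_add// !ge0_integral_mscale.
Qed.

Lemma integral_mixture (f : T -> \bar R) :
  P.-integrable setT f -> Q.-integrable setT f ->
  \int[mixture]_x f x =
  t%:num%:E * \int[P]_x f x + (1 - t%:num)%R%:E * \int[Q]_x f x.
Proof.
move=> iP iQ; have mf := measurable_int _ iP.
have [mp mn] := (measurable_funepos mf, measurable_funeneg mf).
rewrite !(integralE _ _ f) !ge0_integral_mixture//.
have := integrable_pos_fin_num measurableT iP.
have := integrable_neg_fin_num measurableT iP.
have := integrable_pos_fin_num measurableT iQ.
have := integrable_neg_fin_num measurableT iQ.
move=> /fineK <- /fineK <- /fineK <- /fineK <-.
rewrite -!(EFinN, EFinM, EFinD); congr EFin.
by rewrite !mulrBr opprD addrACA.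
Qed.

End mixture.

(** * The entropy of a mixture relative to one of its components *)

Section entropy.
Local Open Scope ereal_scope.
Context {R : realType}.
Implicit Types P Q mu nu : borel_probability R.

(** Allowing the logarithmic potential to grow linearly, rather than asking for
    a bound on the support, gives estimates for every y and not only almost
    every y; the finite first moment makes the linear growth integrable. *)
Definition log_tame mu :=
  \int[mu]_x `|x|%:E < +oo /\
  exists K : R, forall y : R, \int[mu]_x `|logdist x y| <= (K + `|y|)%:E.

Let mabslog y :
  measurable_fun setT (fun x : measurableTypeR R => `|logdist x y|).
Proof. by apply: measurableT_comp => //; exact: measurable_logdist_l. Qed.

Let mabs : measurable_fun setT (fun x : measurableTypeR R => `|x|%:E : \bar R).
Proof. by apply/measurable_EFinP; exact: normr_measurable. Qed.

Lemma log_tame_mixture (t : {i01 R}) P Q :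
  log_tame P -> log_tame Q -> log_tame (mixture t P Q).
Proof.
move=> [P1 [K PK]] [Q1 [L QL]]; have t0 : (0 <= t%:num :> R)%R by [].
have t1 : (0 <= 1 - t%:num :> R)%R by [].
split.
  by rewrite ge0_integral_mixture// lte_add_pinfty// lte_mul_pinfty.
exists (Num.max K L) => y; rewrite ge0_integral_mixture//.
have -> : (Num.max K L + `|y|)%:E = t%:num%:E * (Num.max K L + `|y|)%:E +
    (1 - t%:num)%R%:E * (Num.max K L + `|y|)%:E.
  by rewrite -!(EFinM, EFinD) -mulrDl [(t%:num + _)%R]addrC subrK mul1r.
apply: leeD; apply: lee_pmul => //.
- exact: integral_ge0.
- by apply: le_trans (PK y) _; rewrite lee_fin lerD2r le_max lexx.
- exact: integral_ge0.
- by apply: le_trans (QL y) _; rewrite lee_fin lerD2r le_max lexx orbT.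
Qed.

Lemma log_tame_energy mu nu : log_tame mu -> log_tame nu ->
  \int[nu]_y \int[mu]_x `|logdist x y| < +oo.
Proof.
move=> [_ [K muK]] [nu1 _].
apply: (@le_lt_trans _ _ (\int[nu]_y (`|K|%:E + `|y|%:E))).
  apply: ge0_le_integral => //.
  - by move=> y _; exact: integral_ge0.
  - apply: (measurable_fun_fubini_tonelli_F (m2 := mu)
      (fun z : measurableTypeR R * measurableTypeR R => `|logdist z.2 z.1|)) => //.
    by apply: measurableT_comp => //; exact: measurable_logdist.
  - exact: emeasurable_funD.
  - move=> y _; apply: le_trans (muK y) _.
    by rewrite -EFinD lee_fin lerD2r ler_norm.
rewrite ge0_integralD//.
by rewrite integral_cst//= probability_setT mule1 lte_add_pinfty ?ltry.
Qed.

Lemma log_tame_integrable mu (y : R) : log_tame mu ->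
  mu.-integrable setT (fun x => logdist x y).
Proof.
move=> [_ [K muK]]; apply/integrableP; split; first exact: measurable_logdist_l.
exact: le_lt_trans (muK y) (ltry _).
Qed.

Lemma log_tame_potential_integrable mu nu : log_tame mu -> log_tame nu ->
  nu.-integrable setT (fun y => \int[mu]_x logdist x y).
Proof.
move=> tmu tnu.
have mlog : measurable_fun setT
    (fun z : measurableTypeR R * measurableTypeR R => logdist z.2 z.1).
  exact: measurable_logdist.
apply: (integrable_fubini_F (m1 := nu) (m2 := mu)
  (f := fun z : measurableTypeR R * measurableTypeR R => logdist z.2 z.1)).
by apply/integrable12ltyP => //; exact: log_tame_energy.
Qed.

Lemma integral_diff_mixture (t : {i01 R}) P Q f :
  P.-integrable setT f -> Q.-integrable setT f ->
  integral_diff (mixture t P Q) Q f = t%:num%:E * integral_diff P Q f.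
Proof.
move=> iP iQ; rewrite /integral_diff integral_mixture//.
rewrite -(fineK (integrable_fin_num measurableT iP)).
rewrite -(fineK (integrable_fin_num measurableT iQ)).
rewrite -!(EFinN, EFinM, EFinD); congr EFin.
by rewrite mulrBl mul1r mulrBr addrA addrAC addrK.
Qed.

(** As signed measures, t P + (1 - t) Q - Q = t (P - Q); one factor t comes out
    of the inner integral and one out of the outer integral, and the real K that
    remains is minus the log energy of P - Q. *)
Lemma free_entropy_mixture P Q : log_tame P -> log_tame Q ->
  exists K : R, forall t : {i01 R},
    free_entropy (mixture t P Q) Q = (t%:num ^+ 2 * K)%:E.
Proof.
move=> tP tQ.
pose g y := integral_diff P Q (fun x => logdist x y).
have ig mu : log_tame mu -> mu.-integrable setT g.
  by move=> tmu; apply: integrableB => //; exact: log_tame_potential_integrable.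
exists (- fine (integral_diff P Q g))%R => t.
have tM := log_tame_mixture t P Q tP tQ.
rewrite /free_entropy /finite_log_energy !log_tame_energy//=.
rewrite [X in integral_diff _ _ X](_ : _ = (fun y => t%:num%:E * g y)); last first.
  apply/funext => y.
  by rewrite integral_diff_mixture//; exact: log_tame_integrable.
rewrite integral_diff_mixture; try exact: integrableZl (ig _ _).
rewrite [in X in _ * X]/integral_diff !integralZl//; try exact: ig.
have fP := integrable_fin_num measurableT (ig _ tP).
have fQ := integrable_fin_num measurableT (ig _ tQ).
rewrite /integral_diff -(fineK fP) -(fineK fQ).
rewrite -!(EFinN, EFinM, EFinD); congr EFin.
by rewrite -mulrBr mulrA -expr2 mulrN.
Qed.

End entropy.

(** * A lower bound for the transport distance *)

Section coupling.
Local Open Scope ereal_scope.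
Context {R : realType}.
Implicit Types mu nu : borel_probability R.

(** A coupling carries all the mass that mu puts on A into B, up to a null set,
    and each such displacement has length at least 1; thus the cost of any
    coupling is at least mu A. *)
Lemma wasserstein_ge (p : R) mu nu (A B : set (measurableTypeR R)) :
  (0 < p)%R -> measurable A -> measurable B -> nu (~` B) = 0 ->
  (forall x y, A x -> B y -> 1 <= `|x - y|)%R ->
  mu A `^ p^-1 <= wasserstein p mu nu.
Proof.
move=> p0 mA mB nuB AB1.
have inv_p0 : (0 <= p^-1)%R by rewrite invr_ge0 ltW.
apply: gt0_ler_poweR => //; rewrite ?in_itv/= ?leey ?andbT ?measure_ge0//.
  apply/ereal_infP => _ [pi _ <-]; apply: integral_ge0 => z _.
  by rewrite lee_fin powR_ge0.
apply/ereal_infP => _ [pi pi_coupling <-].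
have [muA _] := pi_coupling _ mA; have [_ nuCB] := pi_coupling _ (measurableC mB).
have mAB : measurable (A `*` B) by exact: measurableX.
have mfstA :
    measurable (fst @^-1` A : set (measurableTypeR R * measurableTypeR R)).
  by rewrite -[X in measurable X]setTI; exact: measurable_fst.
have msndB :
    measurable (snd @^-1` (~` B) : set (measurableTypeR R * measurableTypeR R)).
  rewrite -[X in measurable X]setTI.
  by apply: measurable_snd => //; exact: measurableC.
rewrite -muA /pushforward.
apply: (@le_trans _ _ (pi (A `*` B))).
  rewrite -[leRHS]adde0 -nuB -nuCB /pushforward.
  apply: le_trans (measureU2 _ mAB msndB).
  apply: le_measure; rewrite ?inE//; first exact: measurableU.
  by move=> z Az; have [Bz|nBz] := pselect (B z.2); [left|right].
have -> : pi (A `*` B) = \int[pi]_z (\1_(A `*` B) z)%:E.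
  by rewrite integral_indic// setIT.
apply: ge0_le_integral => //.
- by apply/measurable_EFinP; exact: measurable_indic.
- apply/measurable_EFinP; apply: (@measurableT_comp _ _ _ _ _ _ (@powR R ^~ p)) => //.
  by apply: measurableT_comp => //; exact: measurable_funB.
- move=> z _; rewrite lee_fin indicE.
  case: (boolP (_ \in _)) => [|_] /=; last exact: powR_ge0.
  rewrite inE => -[Az Bz]; have {1}<- : (1 `^ p = 1 :> R)%R by rewrite powR1.
  by apply: ge0_ler_powR; rewrite ?nnegrE ?(ltW p0)//; exact: AB1.
Qed.

End coupling.

(** * Uniform measures *)

Section uniform.
Local Open Scope ereal_scope.
Context {R : realType} (a b : R) (ab : (a < b)%R).
Let U : borel_probability R := uniform_prob ab.
Local Notation leb := (@lebesgue_measure R).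
Local Notation near y r := (`[(y - r)%R, (y + r)%R]%classic : set R).

Lemma uniform_supported (A : set R) : `[a, b] `<=` A -> U (~` A) = 0.
Proof.
move=> abA; rewrite /U/= /uniform_prob integral_uniform_pdf.
rewrite (_ : _ `&` _ = set0) ?integral_set0//.
by apply/seteqP; split => // x [nAx /abA].
Qed.

Let abs_le (x y : R) : x \in `[a, b] -> (`|x - y| <= `|a| + `|b| + `|y|)%R.
Proof.
rewrite in_itv/= => /andP[ax xb]; apply: le_trans (ler_normB _ _) _.
rewrite lerD2r ler_norml.
have := ler_norm b; have := ler_norm (- a); rewrite normrN.
by have := normr_ge0 a; have := normr_ge0 b; lra.
Qed.

Lemma logdist_le (x y : R) : `|logdist x y| <=
  \sum_(k <oo) (\1_(near y (2^-1 ^+ k)%R) x)%:E + `|x - y|%:E.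
Proof.
have := abse_lne_le _ (normr_ge0 (x - y)%R).
rewrite /logdist => /le_trans; apply.
apply: leeD2r; rewrite le_eqVlt; apply/orP; left; apply/eqP.
apply: eq_eseriesr => k _; congr EFin; rewrite !indicE; congr (_%:R).
by congr nat_of_bool; apply/idP/idP; rewrite !inE/= in_itv/= ler_distl.
Qed.

Lemma uniform_layer (y r : R) : (0 <= r)%R ->
  \int[leb]_(x in `[a, b]) (\1_(near y r) x)%:E <= (r *+ 2)%:E.
Proof.
move=> r0; rewrite integral_indic//.
apply: (@le_trans _ _ (leb (near y r))).
  by apply: le_measure; rewrite ?inE//; exact: measurableI.
rewrite lebesgue_measure_itv/= lte_fin; case: ifPn => _.
  by rewrite -EFinB lee_fin mulr2n; lra.
by rewrite lee_fin mulrn_wge0.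
Qed.

Let layers_sum : \sum_(k <oo) ((2^-1 : R) ^+ k *+ 2)%:E = 4%:E :> \bar R.
Proof.
rewrite (eq_eseriesr (g := fun k => (4 / (2 ^ (k + 1))%:R)%:E)).
  apply/cvg_lim => //; have := @cvg_geometric_eseries_half R 4 0.
  by rewrite expr0 divr1.
move=> k _; congr EFin; rewrite addn1 natrX exprVn exprS.
rewrite invfM mulrA -mulr_natl; congr (_ * _)%R; lra.
Qed.

(** Integrating the dyadic bound over [a, b], the k-th layer contributes the
    length of an interval of radius 2^-k, whatever y is, and these lengths sum to
    4; the linear term is at most |a| + |b| + |y|. *)
Lemma uniform_log_tame : log_tame U.
Proof.
have mitv : measurable (`[a, b]%classic : set R) by [].
have leb_fin : leb `[a, b]%classic = (b - a)%:E.
  by rewrite lebesgue_measure_itv/= lte_fin ab EFinB.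
have ba : (0 <= b - a)%R by rewrite subr_ge0 ltW.
have vba : (0 <= (b - a)^-1)%R by rewrite invr_ge0.
have int_norm y : \int[leb]_(x in `[a, b]) `|x - y|%:E <=
    ((`|a| + `|b| + `|y|) * (b - a))%R%:E.
  rewrite EFinM -leb_fin -(integral_cst leb mitv).
  apply: ge0_le_integral => //=.
  - apply/measurable_EFinP; apply: measurable_funTS.
    by apply: measurableT_comp => //; exact: measurable_funB.
  - by move=> x xab; rewrite lee_fin abs_le.
split.
  rewrite /U integral_uniform//; last first.
    by apply/measurable_EFinP; exact: normr_measurable.
  rewrite lte_mul_pinfty// ?lee_fin//.
  apply: le_lt_trans (ltry ((`|a| + `|b| + `|0 : R|) * (b - a))%R).
  apply: le_trans (int_norm 0%R); rewrite le_eqVlt; apply/orP; left; apply/eqP.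
  by apply: eq_integral => x _; rewrite subr0.
exists ((b - a)^-1 * 4 + (`|a| + `|b|))%R => y.
rewrite /U integral_uniform//; last first.
  by apply: measurableT_comp => //; exact: measurable_logdist_l.
have -> : ((b - a)^-1 * 4 + (`|a| + `|b|) + `|y| =
    ((b - a)^-1 * (4 + (`|a| + `|b| + `|y|) * (b - a))))%R.
  rewrite [RHS]mulrDr [X in _ = (_ + X)%R]mulrCA mulVf ?mulr1 ?addrA//.
  by rewrite subr_eq0 gt_eqF.
rewrite EFinM lee_wpmul2l ?lee_fin// EFinD.
pose layer k (x : R) : \bar R := (\1_(near y (2^-1 ^+ k)%R) x)%:E.
have mlayer k : measurable_fun `[a, b]%classic (layer k) by exact/measurable_EFinP.
have layer0 k x : 0 <= layer k x by rewrite lee_fin.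
have mnorm : measurable_fun `[a, b]%classic (fun x : measurableTypeR R => `|x - y|%:E).
  apply/measurable_EFinP; apply: measurable_funTS.
  by apply: measurableT_comp => //; exact: measurable_funB.
have msum : measurable_fun `[a, b]%classic (fun x => \sum_(k <oo) layer k x).
  exact: ge0_emeasurable_sum.
apply: (@le_trans _ _ (\int[leb]_(x in `[a, b]) (\sum_(k <oo) layer k x + `|x - y|%:E))).
  apply: ge0_le_integral => //.
  - apply: measurable_funTS.
    by apply: measurableT_comp => //; exact: measurable_logdist_l.
  - exact: emeasurable_funD.
  - by move=> x _; exact: logdist_le.
rewrite ge0_integralD//; last by move=> x _; exact: nneseries_ge0.
apply: leeD (int_norm y); rewrite integral_nneseries// -layers_sum.
apply: lee_nneseries => k _ *; first exact: integral_ge0.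
by apply: uniform_layer; rewrite exprn_ge0.
Qed.

End uniform.

(** * Letting the transported mass tend to zero *)

(** Since 2/p < 2, the quotient t^2 / t^(2/p) tends to 0.  With t = s^p it equals
    s^(2p - 2), so s is chosen to give this power the prescribed value
    C / (C + |K| + 1), small enough against C / |K| and at most 1. *)
Lemma small_powR {R : realType} (p C K : R) : 1 < p -> 0 < C ->
  exists t : {i01 R}, (t%:num : R) ^+ 2 * K < C * ((t%:num : R) `^ p^-1) ^+ 2.
Proof.
move=> p1 C0; have p0 : 0 < p by lra.
have d0 : 0 < 2 * p - 2 by lra.
pose u := C / (C + `|K| + 1).
have one_powR (z : R) : 1 `^ z = 1 by rewrite powR1.
have K0 := normr_ge0 K.
have u0 : 0 < u by rewrite divr_gt0//; lra.
have u1 : u <= 1 by rewrite ler_pdivrMr; lra.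
have uK : u * K < C.
  apply: (@le_lt_trans _ _ (u * `|K|)).
    by rewrite ler_wpM2l ?ler_norm// ltW.
  by rewrite /u mulrAC ltr_pdivrMr; nra.
pose s := u `^ (2 * p - 2)^-1.
have s0 : 0 < s by exact: powR_gt0.
have s1 : s <= 1.
  by rewrite -(one_powR (2 * p - 2)^-1) ge0_ler_powR ?nnegrE ?invr_ge0// ltW.
have t0 : 0 <= s `^ p by exact: powR_ge0.
have t1 : s `^ p <= 1 by rewrite -(one_powR p) ge0_ler_powR ?nnegrE// ltW.
exists (Itv01 t0 t1) => /=.
rewrite -powRrM divff ?gt_eqF// powRr1 ?(ltW s0)//.
have -> : (s `^ p) ^+ 2 = u * s ^+ 2.
  rewrite -powR_mulrn ?powR_ge0// -powRrM -powR_mulrn ?(ltW s0)//.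
  have {1}-> : u = s `^ (2 * p - 2) by rewrite -powRrM mulVf ?gt_eqF// powRr1// ltW.
  rewrite -powRD; last by rewrite (gt_eqF s0) implybT.
  by congr powR; lra.
by rewrite mulrAC ltr_pM2r// exprn_gt0.
Qed.

Theorem mainTheorem5 (R : realType) (p : R) (hp : 1 < p) :
  ~ exists C : R, 0 < C /\
      forall mu nu : borel_probability R,
        supported_in `[-2, 2] mu -> supported_in `[-2, 2] nu ->
        (C%:E * wasserstein p mu nu ^+ 2 <= free_entropy mu nu)%E.
Proof.
move=> [C [C0 transport]].
have ltP : (-2 < -1 :> R) by lra.
have ltQ : (1 < 2 :> R) by lra.
pose P : borel_probability R := uniform_prob ltP.
pose Q : borel_probability R := uniform_prob ltQ.
have [K entropyE] := free_entropy_mixture P Q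
  (uniform_log_tame _ _ ltP) (uniform_log_tame _ _ ltQ).
have [t] := small_powR p C K hp C0; apply/negP; rewrite -leNgt.
have t0 : 0 <= t%:num :> R by [].
have Psupp (A : set R) : `[-2, -1] `<=` A -> P (~` A) = 0%E by exact: uniform_supported.
have Qsupp (A : set R) : `[1, 2] `<=` A -> Q (~` A) = 0%E by exact: uniform_supported.
have Q_supp : supported_in `[-2, 2] Q.
  by apply: Qsupp => x /=; rewrite !in_itv/= => /andP[? ?]; apply/andP; split; lra.
have P_supp : supported_in `[-2, 2] P.
  by apply: Psupp => x /=; rewrite !in_itv/= => /andP[? ?]; apply/andP; split; lra.
have mix_supp : supported_in `[-2, 2] (mixture t P Q).
  by rewrite /supported_in/= mixtureE P_supp Q_supp !mule0 adde0.
have := transport _ _ mix_supp Q_supp; rewrite entropyE.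
have W_ge : ((t%:num `^ p^-1)%:E <= wasserstein p (mixture t P Q) Q)%E.
  have := @wasserstein_ge R p (mixture t P Q) Q `[-2, -1] `[1, 2].
  rewrite /= (_ : mixture t P Q `[-2, -1] = (t%:num)%:E); last first.
    have mA : measurable (`[-2, -1]%classic : set (measurableTypeR R)) by [].
    rewrite /= mixtureE -[X in P X]setCK probability_setC; last exact: measurableC.
    rewrite Psupp// sube0 mule1 -[X in Q X]setCK Qsupp ?mule0 ?adde0//.
    move=> x /=; rewrite !in_itv/= => /andP[? ?]; apply/negP.
    by rewrite negb_and; apply/orP; right; lra.
  apply => //.
  - by lra.
  - exact: Qsupp.
  - move=> x y /=; rewrite !in_itv/= => /andP[? ?] /andP[? ?].
    by rewrite ler_normr; apply/orP; right; lra.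
move=> h; rewrite -lee_fin; apply: le_trans h.
rewrite EFinM lee_wpmul2l ?lee_fin ?(ltW C0)//.
by rewrite EFin_expe lee_sqr// ?lee_fin ?powR_ge0// poweR_ge0.
Qed.
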